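(* Let $m,n\ge 1$ and let $$A=\begin{pmatrix} H_1 & E^*\\ E & H_2\end{pmatrix},\qquad \widetilde A=\begin{pmatrix} H_1 & O\\ O & H_2\end{pmatrix}$$ be Hermitian matrices, where $H_1$ is $m\times m$, $H_2$ is $n\times n$ and $E$ is $n\times m$, with eigenvalues (counted with multiplicity) $$\lambda_1\ge\lambda_2\ge\cdots\ge\lambda_{m+n}\quad\text{and}\quad \widetilde\lambda_1\ge\widetilde\lambda_2\ge\cdots\ge\widetilde\lambda_{m+n},$$ respectively. Define, for $1\le i\le m+n$, $$\eta_i=\begin{cases}\min_{\mu_2\in\lambda(H_2)}|\widetilde\lambda_i-\mu_2|, & \text{if }\widetilde\lambda_i\in\lambda(H_1),\\ \min_{\mu_1\in\lambda(H_1)}|\widetilde\lambda_i-\mu_1|, & \text{if }\widetilde\lambda_i\in\lambda(H_2),\end{cases}$$ $$\eta=\min_{1\le i\le m+n}\eta_i=\min_{\mu_1\in\lambda(H_1),\,\mu_2\in\lambda(H_2)}|\mu_1-\mu_2|.$$ Then for every $i=1,2,\dots,m+n$, $$|\lambda_i-\widetilde\lambda_i|\le\frac{2\|E\|^2}{\eta_i+\sqrt{\eta_i^2+4\|E\|^2}}\le\frac{2\|E\|^2}{\eta+\sqrt{\eta^2+4\|E\|^2}}.$$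
   Context: Matrices are complex; $E^*$ denotes the conjugate transpose of $E$, $\lambda(X)$ denotes the spectrum (set of eigenvalues) of the square matrix $X$, and $\|Y\|$ denotes the spectral norm of a matrix $Y$, i.e. its largest singular value. If $\widetilde\lambda_i$ belongs to both $\lambda(H_1)$ and $\lambda(H_2)$, both cases in the definition of $\eta_i$ give $\eta_i=0$. A bound of the form $0/0$ (which occurs only if $E=0$) is read as $0$. *)

(* Defs.v *)
From HB Require Import structures.
From mathcomp Require Export all_boot all_order all_algebra.
From mathcomp Require Export sesquilinear spectral.
From mathcomp.real_closed Require Export complex.
From mathcomp Require Export boolp classical_sets reals.

Set Implicit Arguments.
Unset Strict Implicit.
Unset Printing Implicit Defensive.

Import Order.TTheory GRing.Theory Num.Theory.
Export ComplexField.Normc.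

Local Open Scope ring_scope.
Local Open Scope complex_scope.
Local Open Scope sesquilinear_scope.
Local Open Scope classical_set_scope.

(* The least (resp. greatest) element of [S], with junk value 0 when there is
   none; both exist for the finite nonempty sets considered below. *)
Definition set_min (R : realType) (S : set R) : R :=
  xget 0 [set x | S x /\ lbound S x].

Definition set_max (R : realType) (S : set R) : R :=
  xget 0 [set x | S x /\ ubound S x].

(* [lam] lists the eigenvalues of [A], repeated according to their algebraic
   multiplicity, in nonincreasing order; indices start at 0. *)
Definition ordered_eigenvalues (R : realType) (k : nat) (A : 'M[R[i]]_k)
    (lam : 'I_k -> R) : Prop :=
  (forall i j : 'I_k, (i <= j)%N -> lam j <= lam i) /\
  char_poly A = \prod_(i < k) ('X - ((lam i)%:C)%:P).

Definition spectrum (R : realType) (k : nat) (X : 'M[R[i]]_k) : set R[i] :=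
  [set mu | eigenvalue X mu].

(* Square roots of the eigenvalues of [Y^* Y].  When [p < q] this set also
   contains the 0 that is not counted among the [minn p q] singular values of
   [Y]; the largest element, hence [spectral_norm], is not affected. *)
Definition singular_values (R : realType) (p q : nat) (Y : 'M[R[i]]_(p, q)) :
    set R :=
  [set s | 0 <= s /\ spectrum (Y ^t* *m Y) (s ^+ 2)%:C].

Definition spectral_norm (R : realType) (p q : nat) (Y : 'M[R[i]]_(p, q)) : R :=
  set_max (singular_values Y).

(* The number [eta_i] attached to the eigenvalue [x = lam~_i] of
   [block_mx H1 0 0 H2].  When [x] lies in both spectra, each of the two
   defining cases gives 0; when it lies in neither, the value is junk. *)
Definition eigenvalue_gap (R : realType) (m n : nat)
    (H1 : 'M[R[i]]_m) (H2 : 'M[R[i]]_n) (x : R) : R :=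
  if eigenvalue H1 x%:C then set_min [set normc (x%:C - mu) | mu in spectrum H2]
  else if eigenvalue H2 x%:C then
    set_min [set normc (x%:C - mu) | mu in spectrum H1]
  else 0.

(* Main.v *)
Require Import Defs.
From mathcomp Require Import ring lra.

(** The proof is a Courant-Fischer argument with a test vector adapted to the
    block structure.  Write x for the i-th eigenvalue of the block diagonal
    matrix, g for its gap eta_i, e for the spectral norm of E, and delta for
    2 e^2 / (g + sqrt (g^2 + 4 e^2)), which is the nonnegative root of
    delta (delta + g) = e^2.

    Suppose that x is an eigenvalue of H1, so that H2 has no eigenvalue at
    distance less than g from x.  By counting dimensions there is a nonzero
    v = (v1, v2) orthogonal to the eigenvectors of A with eigenvalue below
    lam_i, to those of H1 with eigenvalue above x and to those of H2 with
    eigenvalue above x ([exists_nonzero_annihilated], [ordered_count]).  The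
    eigenvalues of H2 that are at most x are in fact at most x - g, hence

      lam_i |v|^2 <= <A v, v>
        <= x |v1|^2 + (x - g) |v2|^2 + 2 Re <E v1, v2>
        <= x |v1|^2 + (x - g) |v2|^2 + delta |v1|^2 + (delta + g) |v2|^2
        = (x + delta) |v|^2,

    where the cross term is bounded by the weighted arithmetic-geometric
    inequality with weights delta and delta + g, whose product is e^2
    ([cross_term_le], [eigenvalue_le_block]).  So lam_i <= x + delta.  Nothing
    in this changes when the blocks exchange their roles, and applying it to
    the opposite matrix gives lam_i >= x - delta ([eigenvalue_dist_shift]).

    The second inequality holds because the root delta decreases as the gap
    grows ([shift_anti]); the two descriptions of eta agree because all the
    minima involved range over the finitely many distances between an
    eigenvalue of H1 and one of H2 ([min_eigenvalue_gap]).

    Matrices act on row vectors from the right, so E v1 above is v1 E^* in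
    the formulas below. *)

Set Implicit Arguments.
Unset Strict Implicit.
Unset Printing Implicit Defensive.

Import Order.TTheory GRing.Theory Num.Theory.
Local Open Scope ring_scope.
Local Open Scope complex_scope.
Local Open Scope sesquilinear_scope.
Local Open Scope classical_set_scope.

Local Notation "''[' u , v ]" := (dotmx u v) : ring_scope.
Local Notation "''[' u ]" := (dotmx u u) : ring_scope.

(** * Hermitian forms in an orthonormal eigenbasis *)

(** Fewer equations than unknowns.  The equations come as a family over an
    arbitrary finite type because they will be taken from three different
    eigenbases at once. *)
Lemma exists_nonzero_annihilated (F : fieldType) (k : nat) (I : finType)
    (P : {set I}) (f : I -> 'cV[F]_k) :
  (#|P| < k)%N -> exists2 v : 'rV[F]_k, v != 0 & forall i, i \in P -> v *m f i = 0.
Proof.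
move=> ltPk; pose M := \matrix_(a < k, b < #|P|) f (enum_val b) a 0.
have kerM_neq0 : kermx M != 0.
  rewrite -mxrank_eq0 mxrank_ker -lt0n subn_gt0.
  exact: leq_ltn_trans (rank_leq_col M) ltPk.
exists (nz_row (kermx M)); first by rewrite nz_row_eq0.
move=> i Pi; have vM0 : nz_row (kermx M) *m M = 0.
  exact/sub_kermxP/nz_row_sub.
apply/rowP => c; rewrite ord1.
move/rowP/(_ (enum_rank_in Pi i)): vM0; rewrite !mxE => vM0; rewrite -[RHS]vM0.
by apply: eq_bigr => a _; rewrite mxE enum_rankK_in.
Qed.

Section HermitianForms.
Variable R : realType.
Local Notation C := R[i].

(** The rows of [U] are an orthonormal eigenbasis, and [d] the eigenvalues in
    no particular order.  Keeping [U] and [d] explicit, instead of taking the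
    canonical diagonalization of [A], makes the passage to [- A] immediate. *)
Definition unitary_diag k (A U : 'M[C]_k) (d : 'I_k -> R) :=
  U \is unitarymx /\ A = U^t* *m diag_mx (\row_j (d j)%:C) *m U.

Lemma hermsymmx_conj k (A : 'M[C]_k) : A \is hermsymmx -> A^t* = A.
Proof. by move/is_hermitianmxP => {2}->; rewrite scale1r. Qed.

Lemma unitary_diag_exists k (A : 'M[C]_k) :
  A \is hermsymmx -> exists U d, unitary_diag A U d.
Proof.
move=> Aherm; have Ereal := hermitian_spectral_diag_real Aherm.
have /orthomx_spectralP AE := hermitian_normalmx Aherm.
exists (spectralmx A), (fun j => complex.Re (spectral_diag A 0 j)); split.
  exact: spectral_unitarymx.
rewrite {1}AE (invmx_unitary (spectral_unitarymx A)).
congr (_ *m diag_mx _ *m _); apply/rowP => j; rewrite !mxE RRe_real //.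
exact: (mxOverP Ereal).
Qed.

Lemma unitary_diagN k (A U : 'M[C]_k) d :
  unitary_diag A U d -> unitary_diag (- A) U (fun j => - d j).
Proof.
move=> [Uu ->]; split=> //; rewrite -mulNmx -mulmxN -linearN;
  congr (_ *m diag_mx _ *m _).
by apply/rowP => j; rewrite !mxE rmorphN.
Qed.

Lemma unitary_diag_char_poly k (A U : 'M[C]_k) d :
  unitary_diag A U d -> char_poly A = \prod_(j < k) ('X - ((d j)%:C)%:P).
Proof.
move=> [Uu ->]; set D := diag_mx _.
have -> : char_poly (U^t* *m D *m U) = char_poly D.
  rewrite /char_poly /char_poly_mx.
  pose P := map_mx polyC U; pose Q := map_mx polyC (U^t* ).
  have QP : Q *m P = 1%:M.
    rewrite -map_mxM -(invmx_unitary Uu) mulVmx ?unitarymx_unit //.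
    by rewrite map_scalar_mx.
  have -> : 'X%:M - map_mx polyC (U^t* *m D *m U) = Q *m ('X%:M - map_mx polyC D) *m P.
    rewrite !map_mxM mulmxBr mulmxBl; congr (_ - _).
    by rewrite scalar_mxC -mulmxA QP mulmx1.
  rewrite !det_mulmx mulrAC -det_mulmx QP det1 mul1r //.
rewrite char_poly_trig.
  by apply: eq_bigr => j _; rewrite !mxE eqxx mulr1n.
apply/is_trig_mxP => i j ltij; rewrite !mxE; case: eqP => // eij.
by rewrite eij ltnn in ltij.
Qed.

Lemma unitary_diag_eigenvalue k (A U : 'M[C]_k) d (mu : C) :
  unitary_diag A U d -> eigenvalue A mu <-> exists j, mu = (d j)%:C.
Proof.
move=> /unitary_diag_char_poly AE; rewrite eigenvalue_root_char AE.
rewrite /root horner_prod; split.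
  move/eqP/eqP; rewrite prodf_seq_eq0 => /hasP[j _]; rewrite !hornerE subr_eq0.
  by move/eqP=> ->; exists j.
by move=> [j ->]; rewrite (bigD1 j) //= !hornerE subrr mul0r.
Qed.

Lemma dotmx_adj p q (w : 'rV[C]_p) (v : 'rV[C]_q) (B : 'M[C]_(p, q)) :
  '[w *m B, v] = '[w, v *m B^t*].
Proof. by rewrite !dotmxE trmx_mul map_mxM /= trmxCK mulmxA. Qed.

Lemma dotmxC k (u v : 'rV[C]_k) : '[u, v] = ('[v, u])^*%R.
Proof. by rewrite hermC expr0 mul1r. Qed.

Lemma sqnormE k (v : 'rV[C]_k) : '[v] = \sum_j `|v 0 j| ^+ 2.
Proof. by rewrite dotmxE mxE; apply: eq_bigr => j _; rewrite !mxE normCK. Qed.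

(** [(v *m U^t* ) 0 j] is the coordinate of [v] on the [j]-th eigenvector. *)
Lemma unitary_diag_quad k (A U : 'M[C]_k) d (v : 'rV[C]_k) :
  unitary_diag A U d ->
  '[v *m A, v] = \sum_j (d j)%:C * `|(v *m U^t* ) 0 j| ^+ 2.
Proof.
move=> [Uu ->]; rewrite !mulmxA dotmx_adj dotmxE mxE; apply: eq_bigr => j _.
by rewrite mul_mx_diag !mxE normCK; ring.
Qed.

Lemma unitary_sqnorm k (U : 'M[C]_k) (v : 'rV[C]_k) :
  U \is unitarymx -> '[v *m U^t*] = '[v].
Proof. by move=> Uu; rewrite dotmx_adj trmxCK mulmxKtV. Qed.

Lemma quad_le k (A U : 'M[C]_k) d (v : 'rV[C]_k) (x : R) :
    unitary_diag A U d ->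
    (forall j, x < d j -> (v *m U^t* ) 0 j = 0) ->
  '[v *m A, v] <= x%:C * '[v].
Proof.
move=> AUd vU0; rewrite (unitary_diag_quad v AUd).
rewrite -(unitary_sqnorm v (proj1 AUd)) sqnormE mulr_sumr.
apply: ler_sum => j _; case: (ltP x (d j)) => [/vU0-> | le_dx].
  by rewrite normr0 expr0n !mulr0.
by apply: ler_wpM2r; rewrite ?exprn_ge0 // lecR.
Qed.

Lemma quad_ge k (A U : 'M[C]_k) d (v : 'rV[C]_k) (x : R) :
    unitary_diag A U d ->
    (forall j, d j < x -> (v *m U^t* ) 0 j = 0) ->
  x%:C * '[v] <= '[v *m A, v].
Proof.
move=> AUd vU0; have := quad_le (v := v) (x := - x) (unitary_diagN AUd).
rewrite mulmxN linearNl /= rmorphN mulNr lerN2; apply.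
by move=> j; rewrite ltrN2; apply: vU0.
Qed.

(** Weighted arithmetic-geometric inequality, from |w - t u|^2 >= 0 divided by
    t.  [a] stands for the squared norm of the vector that is mapped to [w] by
    a map with squared norm at most [s * t]. *)
Lemma cross_term_le k (w u : 'rV[C]_k) (s t : R) (a : C) :
    0 <= s -> 0 <= t -> 0 <= a -> '[w] <= (s * t)%:C * a ->
  '[w, u] + '[u, w] <= s%:C * a + t%:C * '[u].
Proof.
move=> s0 t0 a0 wle; have u0 : 0 <= '[u] by exact: dnorm_ge0.
move: t0; rewrite le_eqVlt => /predU1P[t0 | tpos].
  (* No division by t is possible, but then w = 0. *)
  have w0 : w = 0.
    apply/eqP; rewrite -(dnorm_eq0 (@dotmx C k)) eq_le dnorm_ge0 andbT.
    by move: wle; rewrite -t0 mulr0 mul0r.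
  by rewrite w0 linear0l linear0r /= -t0 mul0r !addr0 mulr_ge0 // lecR.
have tC : 0 < t%:C :> C by rewrite ltcR.
have tt : (t%:C)^*%R = t%:C :> C by apply/CrealP/complex_realP; exists t.
rewrite -(ler_pM2l tC).
have : 0 <= '[w - t%:C *: u] by exact: dnorm_ge0.
rewrite hnormB /= linearZl_LR !linearZr_LR /= expr0 mul1r !tt rmorphM /= tt (dotmxC u w) /=.
set wu := '[w, u]; set uw := wu^*%R.
set uu := '[u] in u0 *; set ww := '[w] in wle *.

move=> h2; have h1 : 0 <= (s * t)%:C * a - ww by rewrite subr_ge0.
rewrite -subr_ge0; have := addr_ge0 h1 h2; rewrite rmorphM /=.
by congr (0 <= _); ring.
Qed.

(** * Finite minima and the spectral norm *)

Lemma hermitian_gram p q (Y : 'M[C]_(p, q)) : Y^t* *m Y \is hermsymmx.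
Proof.
by apply/is_hermitianmxP; rewrite scale1r trmx_mul map_mxM /= trmxCK.
Qed.

Lemma unitary_diag_gram_ge0 p q (Y : 'M[C]_(p, q)) V d :
  unitary_diag (Y^t* *m Y) V d -> forall j, 0 <= d j.
Proof.
move=> YVd j; have : eigenvalue (Y^t* *m Y) (d j)%:C.
  by apply/(unitary_diag_eigenvalue _ YVd); exists j.
case/eigenvalueP => v vE v0.
have : 0 <= '[v *m Y^t*] by exact: dnorm_ge0.
rewrite -dotmx_adj -mulmxA vE linearZl_LR /= pmulr_lge0 ?lecR //.
exact: dotmx_is_dotmx.
Qed.

Lemma set_minE (S : set R) y : S y -> lbound S y -> set_min S = y.
Proof.
move=> Sy lby; rewrite /set_min; case: xgetP => [z _ [Sz lbz]|/(_ y)[]//].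
by apply: le_anti; rewrite lbz //= lby.
Qed.

Lemma set_maxE (S : set R) y : S y -> ubound S y -> set_max S = y.
Proof.
move=> Sy uby; rewrite /set_max; case: xgetP => [z _ [Sz ubz]|/(_ y)[]//].
by apply: le_anti; rewrite ubz //= uby.
Qed.

(** The sets of gaps and of singular values will all be presented as ranges of
    functions on finite types, where the extrema are attained. *)
Lemma set_min_range (I : finType) (i0 : I) (f : I -> R) :
  (exists i, set_min (range f) = f i) /\ forall i, set_min (range f) <= f i.
Proof.
have [i _ fi_min] := arg_minP f (erefl (xpredT i0)).
have -> : set_min (range f) = f i.
  by apply: set_minE; [exists i | move=> _ [j _ <-]; apply: fi_min].
by split=> [|j]; [exists i | apply: fi_min].
Qed.

Lemma set_max_range (I : finType) (i0 : I) (f : I -> R) :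
  (exists i, set_max (range f) = f i) /\ forall i, f i <= set_max (range f).
Proof.
have [i _ fi_max] := arg_maxP f (erefl (xpredT i0)).
have -> : set_max (range f) = f i.
  by apply: set_maxE; [exists i | move=> _ [j _ <-]; apply: fi_max].
by split=> [|j]; [exists i | apply: fi_max].
Qed.

(** The squared length of the image of [w] is the Hermitian form of
    [Y^t* *m Y], whose largest eigenvalue is the square of the largest
    singular value. *)
Lemma spectral_norm_bound p q (Y : 'M[C]_(p, q)) (w : 'rV[C]_q) :
  (0 < q)%N -> '[w *m Y^t*] <= (spectral_norm Y ^+ 2)%:C * '[w].
Proof.
move=> q0; have [V [d YVd]] := unitary_diag_exists (hermitian_gram Y).
have d0 := unitary_diag_gram_ge0 YVd.
have svE : singular_values Y = range (fun j => Num.sqrt (d j)).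
  apply/seteqP; split=> [s [s0 /(unitary_diag_eigenvalue _ YVd)[j /complexI sE]]|].
    by exists j => //=; rewrite -sE sqrtr_sqr ger0_norm.
  move=> _ [j _ <-]; split; first exact: sqrtr_ge0.
  by apply/(unitary_diag_eigenvalue _ YVd); exists j; rewrite sqr_sqrtr.
have [_ le_norm] := set_max_range (Ordinal q0) (fun j => Num.sqrt (d j)).
rewrite -dotmx_adj -mulmxA; apply: (quad_le YVd) => j; rewrite ltNge => /negP[].
rewrite -(sqr_sqrtr (d0 j)) /spectral_norm svE lerXn2r ?nnegrE ?sqrtr_ge0 //.
exact: le_trans (sqrtr_ge0 _) (le_norm j).
Qed.

Lemma spectral_norm_ge0 p q (Y : 'M[C]_(p, q)) : 0 <= spectral_norm Y.
Proof. by rewrite /spectral_norm /set_max; case: xgetP => // s _ [[]]. Qed.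

(** * Bounding an eigenvalue of a block matrix *)

Lemma dotmx_row_mx p q (a c : 'rV[C]_p) (b d : 'rV[C]_q) :
  '[row_mx a b, row_mx c d] = '[a, c] + '[b, d].
Proof. by rewrite !dotmxE tr_row_mx map_col_mx mul_row_col mxE. Qed.

Definition nb_lt (I : finType) (f : I -> R) (a : R) := #|[pred j | f j < a]|.
Definition nb_gt (I : finType) (f : I -> R) (a : R) := #|[pred j | a < f j]|.

(** The test vector argument.  The thresholds [x1] and [x2] may differ: this is
    what lets a gap on the side of either block be exploited, and it makes the
    statement symmetric in the two blocks. *)
Lemma eigenvalue_le_block m n (H1 : 'M[C]_m) (H2 : 'M[C]_n) (E : 'M[C]_(n, m))
    U U1 U2 (d : 'I_(m + n) -> R) (d1 : 'I_m -> R) (d2 : 'I_n -> R)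
    (a x1 x2 s t c : R) :
    unitary_diag (block_mx H1 (E^t* ) E H2) U d ->
    unitary_diag H1 U1 d1 -> unitary_diag H2 U2 d2 ->
    (forall w, '[w *m E^t*] <= (s * t)%:C * '[w]) ->
    0 <= s -> 0 <= t -> x1 + s = c -> x2 + t = c ->
    (nb_lt d a + (nb_gt d1 x1 + nb_gt d2 x2) < m + n)%N ->
  a <= c.
Proof.
move=> AUd HUd1 HUd2 leE s0 t0 x1s x2t ltN.
pose f (i : 'I_(m + n) + ('I_m + 'I_n)) : 'cV[C]_(m + n) :=
  match i with
  | inl j => col j (U^t* )
  | inr (inl j) => col_mx (col j (U1^t* )) 0
  | inr (inr j) => col_mx 0 (col j (U2^t* ))
  end.
pose inr1 (j : 'I_m) : 'I_(m + n) + ('I_m + 'I_n) := inr (inl j).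
pose inr2 (j : 'I_n) : 'I_(m + n) + ('I_m + 'I_n) := inr (inr j).
pose P : {set 'I_(m + n) + ('I_m + 'I_n)} := (inl @: [pred j | (d j < a)%R]
  :|: (inr1 @: [pred j | (x1 < d1 j)%R] :|: inr2 @: [pred j | (x2 < d2 j)%R]))%SET.
have ltP : (#|P| < m + n)%N.
  apply: leq_ltn_trans ltN; apply: leq_trans (leq_card_setU _ _) _.
  apply: leq_add; first exact: leq_imset_card.
  apply: leq_trans (leq_card_setU _ _) _.
  by apply: leq_add; exact: leq_imset_card.
have [v v_neq0 vP] := exists_nonzero_annihilated f ltP.
have entry k (w : 'rV[C]_k) (B : 'M[C]_k) j : (w *m B) 0 j = (w *m col j B) 0 0.
  by rewrite !mxE; apply: eq_bigr => l _; rewrite mxE.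
set v1 := lsubmx v; set v2 := rsubmx v.
have vE : v = row_mx v1 v2 by rewrite hsubmxK.
have ge_a : a%:C * '[v] <= '[v *m block_mx H1 (E^t* ) E H2, v].
  apply: (quad_ge AUd) => j ltja; rewrite entry (vP (inl j)) ?mxE //.
  by rewrite inE; apply/orP; left; apply/imsetP; exists j; rewrite ?inE.
have le1 : '[v1 *m H1, v1] <= x1%:C * '[v1].
  apply: (quad_le HUd1) => j ltj; rewrite entry.
  have := vP (inr1 j); rewrite /= vE mul_row_col mulmx0 addr0 => -> //.
    by rewrite mxE.
  by rewrite !inE; apply/orP; right; apply/orP; left; apply/imsetP; exists j; rewrite ?inE.
have le2 : '[v2 *m H2, v2] <= x2%:C * '[v2].
  apply: (quad_le HUd2) => j ltj; rewrite entry.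
  have := vP (inr2 j); rewrite /= vE mul_row_col mulmx0 add0r => -> //.
    by rewrite mxE.
  by rewrite !inE; apply/orP; right; apply/orP; right; apply/imsetP; exists j; rewrite ?inE.
have le12 : '[v1 *m E^t*, v2] + '[v2, v1 *m E^t*] <= s%:C * '[v1] + t%:C * '[v2].
  by apply: cross_term_le (leE v1) => //; apply: dnorm_ge0.
have sum_le (q1 q2 b1 b2 z z' : C) : b1 <= x1%:C * q1 -> b2 <= x2%:C * q2 ->
    z + z' <= s%:C * q1 + t%:C * q2 ->
  b1 + z' + (z + b2) <= c%:C * (q1 + q2).
  move=> le1' le2' lez; rewrite mulrDr -{1}x1s -x2t !rmorphD !mulrDl.
  have := lerD (lerD le1' le2') lez.
  rewrite (_ : b1 + z' + (z + b2) = b1 + b2 + (z + z')); last by ring.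
  by move/le_trans; apply; rewrite addrACA.
have v_gt0 : 0 < '[v] by exact: dotmx_is_dotmx.
have {}ge_a : a%:C * '[v] <= c%:C * '[v].
  apply: (le_trans ge_a); rewrite vE mul_row_block !dotmx_row_mx.
  rewrite !linearDl /= (dotmx_adj v2 v1 E).
  exact: sum_le.
by move: ge_a; rewrite ler_pM2r // lecR.
Qed.

(** * The root of the quadratic equation *)

Definition shift (e eta : R) := 2 * e ^+ 2 / (eta + Num.sqrt (eta ^+ 2 + 4 * e ^+ 2)).

Lemma shift_ge0 e eta : 0 <= eta -> 0 <= shift e eta.
Proof.
by move=> eta0; apply: divr_ge0; [rewrite mulr_ge0 ?sqr_ge0 | rewrite addr_ge0 ?sqrtr_ge0].
Qed.

(** Rationalizing the denominator, [shift e eta] is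
    (sqrt (eta^2 + 4 e^2) - eta) / 2, the larger eigenvalue of the matrix with
    rows (0, e) and (e, - eta). *)
Lemma shift_root e eta : 0 <= eta -> shift e eta * (shift e eta + eta) = e ^+ 2.
Proof.
move=> eta0; rewrite /shift; set D := Num.sqrt _.
have D0 : 0 <= D by apply: sqrtr_ge0.
have DE : D ^+ 2 = eta ^+ 2 + 4 * e ^+ 2.
  by rewrite sqr_sqrtr // addr_ge0 ?sqr_ge0 // mulr_ge0 ?sqr_ge0.
have [sum0|sum_neq0] := eqVneq (eta + D) 0.
  (* The quotient is then 0 by convention, in accordance with e = 0. *)
  have [eta_eq0 D_eq0] : eta = 0 /\ D = 0 by split; lra.
  rewrite sum0 invr0 mulr0 mul0r; move: DE; rewrite eta_eq0 D_eq0; lra.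
have -> : e ^+ 2 = (D - eta) * (eta + D) / 4.
  have -> : (D - eta) * (eta + D) = D ^+ 2 - eta ^+ 2 by ring.
  by rewrite DE; field.
by field.
Qed.

(** The products in [shift_root] agree for both gaps, so a larger gap leaves
    room only for a smaller root. *)
Lemma shift_anti e eta eta' : 0 <= eta -> eta <= eta' -> shift e eta' <= shift e eta.
Proof.
move=> eta0 le_eta; have eta'0 := le_trans eta0 le_eta.
have := shift_root e eta0; have := shift_root e eta'0.
have := shift_ge0 e eta0; have := shift_ge0 e eta'0.
move: (shift e eta) (shift e eta') => s s' s'0 s0 s'E sE.
rewrite leNgt; apply/negP => lts.
have : s * (s + eta) < s' * (s' + eta') by apply: ltr_pM => //; lra.
by rewrite s'E sE ltxx.
Qed.

(** * Two-sided bounds *)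

(** An eigenvalue of a block that is at most [x] is at most [x] minus the gap of
    that block, so lowering the thresholds to [x - g1] and [x - g2] adds no
    equation for the test vector.  One of [g1] and [g2] will be 0 and the other
    the gap of [x]. *)
Lemma eigenvalue_le_shift m n (H1 : 'M[C]_m) (H2 : 'M[C]_n) (E : 'M[C]_(n, m))
    U U1 U2 (d : 'I_(m + n) -> R) (d1 : 'I_m -> R) (d2 : 'I_n -> R)
    (e delta a x g1 g2 : R) :
    unitary_diag (block_mx H1 (E^t* ) E H2) U d ->
    unitary_diag H1 U1 d1 -> unitary_diag H2 U2 d2 ->
    (forall w, '[w *m E^t*] <= (e ^+ 2)%:C * '[w]) ->
    0 <= delta -> 0 <= g1 -> 0 <= g2 ->
    (delta + g1) * (delta + g2) = e ^+ 2 ->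
    (forall j, g1 <= `|x - d1 j|) -> (forall j, g2 <= `|x - d2 j|) ->
    (nb_lt d a + (nb_gt d1 x + nb_gt d2 x) < m + n)%N ->
  a <= x + delta.
Proof.
move=> AUd HUd1 HUd2 leE delta0 g1_0 g2_0 gE gap1 gap2 ltN.
have nb_gap (I : finType) (f : I -> R) g : (forall j, g <= `|x - f j|) ->
    (nb_gt f (x - g) <= nb_gt f x)%N.
  move=> gap; apply/subset_leq_card/fintype.subsetP => j; rewrite !inE.
  move=> lt_xg; rewrite ltNge; apply/negP => le_fx.
  by have := gap j; rewrite ger0_norm; lra.
apply: (eigenvalue_le_block (x1 := x - g1) (x2 := x - g2) (s := delta + g1)
  (t := delta + g2) AUd HUd1 HUd2); rewrite ?gE ?addr_ge0 //; try lra.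
by apply: leq_ltn_trans ltN; rewrite !leq_add2l leq_add ?nb_gap.
Qed.

(** The opposite matrices have the same eigenvectors and the same gaps, so the
    lower bound is the upper bound for them. *)
Lemma eigenvalue_dist_shift m n (H1 : 'M[C]_m) (H2 : 'M[C]_n) (E : 'M[C]_(n, m))
    U U1 U2 (d : 'I_(m + n) -> R) (d1 : 'I_m -> R) (d2 : 'I_n -> R)
    (e delta a x g1 g2 : R) :
    unitary_diag (block_mx H1 (E^t* ) E H2) U d ->
    unitary_diag H1 U1 d1 -> unitary_diag H2 U2 d2 ->
    (forall w, '[w *m E^t*] <= (e ^+ 2)%:C * '[w]) ->
    0 <= delta -> 0 <= g1 -> 0 <= g2 ->
    (delta + g1) * (delta + g2) = e ^+ 2 ->
    (forall j, g1 <= `|x - d1 j|) -> (forall j, g2 <= `|x - d2 j|) ->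
    (nb_lt d a + (nb_gt d1 x + nb_gt d2 x) < m + n)%N ->
    (nb_gt d a + (nb_lt d1 x + nb_lt d2 x) < m + n)%N ->
  `|a - x| <= delta.
Proof.
move=> AUd HUd1 HUd2 leE delta0 g1_0 g2_0 gE gap1 gap2 ltN gtN.
have le_a := eigenvalue_le_shift AUd HUd1 HUd2 leE delta0 g1_0 g2_0 gE
  gap1 gap2 ltN.
have nb_ltN (I : finType) (f : I -> R) y :
    nb_lt (fun j => - f j) (- y) = nb_gt f y.
  by apply: eq_card => j; rewrite !inE ltrN2.
have nb_gtN (I : finType) (f : I -> R) y :
    nb_gt (fun j => - f j) (- y) = nb_lt f y.
  by apply: eq_card => j; rewrite !inE ltrN2.
have : - a <= - x + delta.
  have ANd := unitary_diagN AUd.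
  rewrite opp_block_mx -map_mxN -linearN in ANd.
  apply: (eigenvalue_le_shift ANd (unitary_diagN HUd1) (unitary_diagN HUd2) _
    delta0 g1_0 g2_0 gE).
  - move=> w; rewrite linearN /= map_mxN mulmxN linearNl /= linearNr /= opprK.
    exact: leE.
  - by move=> j; rewrite -opprD normrN.
  - by move=> j; rewrite -opprD normrN.
  - by rewrite nb_ltN !nb_gtN.
by rewrite ler_norml; lra.
Qed.

(** * Counting eigenvalues *)

Lemma prod_XsubC_codom k (d : 'I_k -> R) :
  \prod_(j < k) ('X - ((d j)%:C)%:P) = \prod_(x <- codom d) ('X - (x%:C)%:P) :> {poly C}.
Proof. by rewrite big_map big_enum. Qed.

Lemma char_poly_block_diag m n (H1 : 'M[C]_m) (H2 : 'M[C]_n) :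
  char_poly (block_mx H1 0 0 H2) = char_poly H1 * char_poly H2.
Proof. by rewrite /char_poly char_block_diag_mx det_ublock. Qed.

(** A diagonalization lists the eigenvalues in an uncontrolled order; that it
    agrees with a sorted list up to permutation, which is all that counting
    needs, is read off from the characteristic polynomials. *)
Lemma perm_eq_real_roots (s t : seq R) :
    \prod_(x <- s) ('X - (x%:C)%:P) = \prod_(x <- t) ('X - (x%:C)%:P) :> {poly C} ->
  perm_eq s t.
Proof.
move=> eqst; apply: (perm_map_inj (@complexI R)).
by apply: prod_XsubC_eq; rewrite !big_map.
Qed.

Lemma card_count (I : finType) (f : I -> R) (p : pred R) :
  #|[pred j | p (f j)]| = count p (codom f).
Proof. by rewrite count_map enumT -size_filter cardE; congr size. Qed.

Lemma nb_perm k l (f : 'I_k -> R) (g : 'I_l -> R) :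
  perm_eq (codom f) (codom g) ->
  forall a, nb_lt f a = nb_lt g a /\ nb_gt f a = nb_gt g a.
Proof.
move=> /permP fg a; split; last by rewrite /nb_gt !(card_count _ (> a)).
by rewrite /nb_lt !(card_count _ (< a)).
Qed.

Lemma nb_perm_cat k l N (f : 'I_k -> R) (g : 'I_l -> R) (h : 'I_N -> R) :
    perm_eq (codom f ++ codom g) (codom h) ->
  forall a, (nb_lt f a + nb_lt g a = nb_lt h a)%N /\ (nb_gt f a + nb_gt g a = nb_gt h a)%N.
Proof.
move=> /permP fg a; split.
  by rewrite /nb_lt !(card_count _ (< a)) -count_cat.
by rewrite /nb_gt !(card_count _ (> a)) -count_cat.
Qed.

(** The entries counted on the left come after position [i], those counted on
    the right before it, and [i] itself is counted on neither side. *)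
Lemma ordered_count k (lam mu : 'I_k -> R) i :
    (forall i j : 'I_k, (i <= j)%N -> lam j <= lam i) ->
    (forall i j : 'I_k, (i <= j)%N -> mu j <= mu i) ->
  (nb_lt lam (lam i) + nb_gt mu (mu i) < k)%N.
Proof.
move=> lam_mono mu_mono; rewrite -cardUI [X in (_ + X)%N]eq_card0 => [|j].
  rewrite addn0 -[k in (_ < k)%N]card_ord; apply/proper_card/properP.
  by split; [apply/fintype.subsetP | exists i; rewrite ?inE // !ltxx].
rewrite !inE; apply/negP => /andP[lt_lam lt_mu]; have [le_ij|/ltnW le_ji] := leqP i j.
  by have := mu_mono _ _ le_ij; rewrite leNgt lt_mu.
by have := lam_mono _ _ le_ji; rewrite leNgt lt_lam.
Qed.

(** * Gaps between the two spectra *)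

Lemma block_diag_hermsymmx m n (H1 : 'M[C]_m) (H2 : 'M[C]_n) :
  block_mx H1 0 0 H2 \is hermsymmx -> H1 \is hermsymmx /\ H2 \is hermsymmx.
Proof.
move=> /hermsymmx_conj; rewrite tr_block_mx map_block_mx.
by move=> /eq_block_mx[h1 _ _ h2]; split; apply/is_hermitianmxP; rewrite scale1r.
Qed.

Lemma normc_real (x : R) : normc x%:C = `|x|.
Proof. by rewrite /= expr0n addr0 sqrtr_sqr. Qed.

Lemma spectrum_dist k (A U : 'M[C]_k) d (x : R) :
    unitary_diag A U d ->
  [set normc (x%:C - mu) | mu in spectrum A] = range (fun j => `|x - d j|).
Proof.
move=> AUd; apply/seteqP; split=> y.
  case=> mu /(unitary_diag_eigenvalue _ AUd)[j ->] <-.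
  by exists j => //; rewrite -rmorphB normc_real.
case=> j _ <-; exists (d j)%:C; first by apply/(unitary_diag_eigenvalue _ AUd); exists j.
by rewrite -rmorphB normc_real.
Qed.

Lemma eigenvalue_gap_left m n (H1 U1 : 'M[C]_m) (H2 U2 : 'M[C]_n)
    (d1 : 'I_m -> R) (d2 : 'I_n -> R) (j : 'I_m) :
    (0 < n)%N ->
    unitary_diag H1 U1 d1 -> unitary_diag H2 U2 d2 ->
  (exists k, eigenvalue_gap H1 H2 (d1 j) = `|d1 j - d2 k|) /\
  forall k, eigenvalue_gap H1 H2 (d1 j) <= `|d1 j - d2 k|.
Proof.
move=> n_gt0 HUd1 HUd2.
have H1j : eigenvalue H1 (d1 j)%:C.
  by apply/(unitary_diag_eigenvalue _ HUd1); exists j.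
rewrite /eigenvalue_gap H1j (spectrum_dist _ HUd2).
exact: (set_min_range (Ordinal n_gt0)).
Qed.

Lemma eigenvalue_gap_right m n (H1 U1 : 'M[C]_m) (H2 U2 : 'M[C]_n)
    (d1 : 'I_m -> R) (d2 : 'I_n -> R) (k : 'I_n) :
    (0 < m)%N ->
    unitary_diag H1 U1 d1 -> unitary_diag H2 U2 d2 ->
    ~~ eigenvalue H1 (d2 k)%:C ->
  (exists j, eigenvalue_gap H1 H2 (d2 k) = `|d2 k - d1 j|) /\
  forall j, eigenvalue_gap H1 H2 (d2 k) <= `|d2 k - d1 j|.
Proof.
move=> m_gt0 HUd1 HUd2 /negPf H1F; have H2k : eigenvalue H2 (d2 k)%:C.
  by apply/(unitary_diag_eigenvalue _ HUd2); exists k.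
rewrite /eigenvalue_gap H1F H2k (spectrum_dist _ HUd1).
exact: (set_min_range (Ordinal m_gt0)).
Qed.

(** The two cases in the definition of the gap, put in the symmetric form that
    [eigenvalue_dist_shift] takes: the distance from [x] to the spectrum of its
    own block has only the trivial bound 0. *)
Lemma eigenvalue_gap_spec m n (H1 U1 : 'M[C]_m) (H2 U2 : 'M[C]_n)
    (d1 : 'I_m -> R) (d2 : 'I_n -> R) x :
    (0 < m)%N -> (0 < n)%N ->
    unitary_diag H1 U1 d1 -> unitary_diag H2 U2 d2 ->
    x \in codom d1 ++ codom d2 ->
  let eta := eigenvalue_gap H1 H2 x in
  (exists j k, eta = `|d1 j - d2 k|) /\
  exists g1 g2, [/\ g1 = 0 /\ g2 = eta \/ g1 = eta /\ g2 = 0,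
    forall j, g1 <= `|x - d1 j| & forall k, g2 <= `|x - d2 k|].
Proof.
move=> m_gt0 n_gt0 HUd1 HUd2; rewrite mem_cat => x_eig eta; rewrite /eta.
have [/(unitary_diag_eigenvalue _ HUd1)[j /complexI ->]|NH1x] :=
  boolP (eigenvalue H1 x%:C).
  have [[k kE] le_k] := eigenvalue_gap_left j n_gt0 HUd1 HUd2.
  split; first by exists j, k.
  by exists 0, (eigenvalue_gap H1 H2 (d1 j)); split=> //; left.
case/orP: x_eig NH1x => /codomP[k ->].
  by case/negP; apply/(unitary_diag_eigenvalue _ HUd1); exists k.
move=> /(eigenvalue_gap_right m_gt0 HUd1 HUd2)[[j jE] le_j].
split; first by exists j, k; rewrite distrC.
by exists (eigenvalue_gap H1 H2 (d2 k)), 0; split=> //; right.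
Qed.

Lemma spectra_dist m n (H1 U1 : 'M[C]_m) (H2 U2 : 'M[C]_n)
    (d1 : 'I_m -> R) (d2 : 'I_n -> R) :
    unitary_diag H1 U1 d1 -> unitary_diag H2 U2 d2 ->
  [set normc (mu1 - mu2) | mu1 in spectrum H1 & mu2 in spectrum H2] =
  range (fun p : 'I_m * 'I_n => `|d1 p.1 - d2 p.2|).
Proof.
move=> HUd1 HUd2; apply/seteqP; split=> y.
  case=> mu1 /(unitary_diag_eigenvalue _ HUd1)[j ->].
  case=> mu2 /(unitary_diag_eigenvalue _ HUd2)[k ->] <-.
  by exists (j, k) => //; rewrite -rmorphB normc_real.
case=> [[j k] _ <-]; exists (d1 j)%:C.
  by apply/(unitary_diag_eigenvalue _ HUd1); exists j.
exists (d2 k)%:C; first by apply/(unitary_diag_eigenvalue _ HUd2); exists k.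
by rewrite -rmorphB normc_real.
Qed.

(** The distance between an eigenvalue of [H1] and one of [H2] is at least the
    gap of the former, which occurs somewhere in [lamt]; conversely each gap is
    such a distance. *)
Lemma min_eigenvalue_gap m n (H1 U1 : 'M[C]_m) (H2 U2 : 'M[C]_n)
    (d1 : 'I_m -> R) (d2 : 'I_n -> R) N
    (lamt : 'I_N -> R) :
    (0 < m)%N -> (0 < n)%N ->
    unitary_diag H1 U1 d1 -> unitary_diag H2 U2 d2 ->
    perm_eq (codom d1 ++ codom d2) (codom lamt) ->
  let eta_ i := eigenvalue_gap H1 H2 (lamt i) in
  set_min (range eta_) =
    set_min [set normc (mu1 - mu2) | mu1 in spectrum H1 & mu2 in spectrum H2] /\
  forall i, set_min (range eta_) <= eta_ i.
Proof.
move=> m_gt0 n_gt0 HUd1 HUd2 eq_lamt eta_.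
have lamtE j : exists i, d1 j = lamt i.
  by apply/codomP; rewrite -(perm_mem eq_lamt) mem_cat codom_f.
have [i0 _] := lamtE (Ordinal m_gt0).
have [[i iE] le_i] := set_min_range i0 eta_; split=> //.
apply/esym/set_minE; rewrite (spectra_dist HUd1 HUd2).
  have xi : lamt i \in codom d1 ++ codom d2 by rewrite (perm_mem eq_lamt) codom_f.
  have [[j [k jkE]] _] := eigenvalue_gap_spec m_gt0 n_gt0 HUd1 HUd2 xi.
  by exists (j, k) => //=; rewrite -jkE.
move=> _ [[j k] _ <-] /=; have [i' i'E] := lamtE j.
apply: le_trans (le_i i') _; rewrite /eta_ -i'E.
exact: (proj2 (eigenvalue_gap_left j n_gt0 HUd1 HUd2)).
Qed.

End HermitianForms.

Theorem theorem2 (R : realType) (m n : nat) (hm : (1 <= m)%N) (hn : (1 <= n)%N)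
    (H1 : 'M[R[i]]_m) (H2 : 'M[R[i]]_n) (E : 'M[R[i]]_(n, m))
    (hA : block_mx H1 (E ^t* ) E H2 \is hermsymmx)
    (hAt : block_mx H1 0 0 H2 \is hermsymmx)
    (lam lamt : 'I_(m + n) -> R)
    (hlam : ordered_eigenvalues (block_mx H1 (E ^t* ) E H2) lam)
    (hlamt : ordered_eigenvalues (block_mx H1 0 0 H2) lamt) :
  let eta_ := fun i => eigenvalue_gap H1 H2 (lamt i) in
  let eta := set_min (range eta_) in
  let normE := spectral_norm E in
  eta = set_min [set normc (mu1 - mu2) | mu1 in spectrum H1 & mu2 in spectrum H2]
  /\ forall i : 'I_(m + n),
       `|lam i - lamt i|
         <= 2 * normE ^+ 2 / (eta_ i + Num.sqrt (eta_ i ^+ 2 + 4 * normE ^+ 2))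
       <= 2 * normE ^+ 2 / (eta + Num.sqrt (eta ^+ 2 + 4 * normE ^+ 2)).
Proof.
move=> eta_ eta normE.
have [U [d AUd]] := unitary_diag_exists hA.
have [H1herm H2herm] := block_diag_hermsymmx hAt.
have [U1 [d1 HUd1]] := unitary_diag_exists H1herm.
have [U2 [d2 HUd2]] := unitary_diag_exists H2herm.
have [lam_mono lamE] := hlam; have [lamt_mono lamtE] := hlamt.
have d_lam : perm_eq (codom d) (codom lam).
  by apply: perm_eq_real_roots; rewrite -!prod_XsubC_codom -lamE (unitary_diag_char_poly AUd).
have d12_lamt : perm_eq (codom d1 ++ codom d2) (codom lamt).
  apply: perm_eq_real_roots; rewrite big_cat /= -!prod_XsubC_codom -lamtE char_poly_block_diag.
  by rewrite (unitary_diag_char_poly HUd1) (unitary_diag_char_poly HUd2).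
have [etaE eta_min] := min_eigenvalue_gap hm hn HUd1 HUd2 d12_lamt.
have lamt_eig i : lamt i \in codom d1 ++ codom d2.
  by rewrite (perm_mem d12_lamt) codom_f.
have eta_ge0 i : 0 <= eta_ i.
  have [[j [k gapE]] _] := eigenvalue_gap_spec hm hn HUd1 HUd2 (lamt_eig i).
  by rewrite /eta_ gapE normr_ge0.
have eta0 : 0 <= eta.
  by have [[i etaEi] _] := set_min_range (Ordinal (ltn_addr n hm)) eta_;
    rewrite /eta etaEi.
split=> // i; rewrite -/(shift normE (eta_ i)) -/(shift normE eta).
apply/andP; split; last exact: shift_anti (eta_min i).
have [_ [g1 [g2 [g12 gap1 gap2]]]] := eigenvalue_gap_spec hm hn HUd1 HUd2 (lamt_eig i).
have leE w := spectral_norm_bound E w hm.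
apply: (eigenvalue_dist_shift (g1 := g1) (g2 := g2) AUd HUd1 HUd2 leE) => //.
- exact: shift_ge0.
- by case: g12 => -[-> _] //; apply: eta_ge0.
- by case: g12 => -[_ ->] //; apply: eta_ge0.
- rewrite -(shift_root normE (eta_ge0 i)).
  by case: g12 => -[-> ->]; rewrite addr0 // mulrC.
- rewrite (proj1 (nb_perm d_lam _)) (proj2 (nb_perm_cat d12_lamt _)).
  exact: ordered_count.
rewrite (proj2 (nb_perm d_lam _)) (proj1 (nb_perm_cat d12_lamt _)) addnC.
exact: ordered_count.
Qed.
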